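(* Let $\mathbb{K}$ be a field of characteristic $0$ and let $(\lambda,\mu)$ and $(\vartheta,\omega)$ be bipartitions of $n$. The following are equivalent: (1) $(\lambda,\mu)$ bidominates $(\vartheta,\omega)$, i.e. $(\vartheta,\omega)\unlhd(\lambda,\mu)$; (2) $I_{(\vartheta,\omega)}\subset I_{(\lambda,\mu)}$; (3) $V_{(\lambda,\mu)}\subset V_{(\vartheta,\omega)}$.
   Context: A partition of $n$ is a non-increasing sequence of non-negative integers summing to $n$ (entries beyond its length are $0$; $\emptyset$ is the partition of $0$). A bipartition of $n$ is a pair $(\lambda,\mu)$ of partitions with $|\lambda|+|\mu|=n$. A bitableau of shape $(\lambda,\mu)$ is a filling of the pair of Young diagrams of shapes $\lambda$ and $\mu$ (row $i$ having $\lambda_i$, resp. $\mu_i$, boxes) with the numbers $1,\dots,n$, each used once. For a sequence $(i_1,\dots,i_m)$ let $\Delta_{(i_1,\dots,i_m)}(\mathbf{y})=\prod_{1\le j<k\le m}(y_{i_j}-y_{i_k})$ (equal to $1$ if $m=1$). For a bitableau $(T,S)$ with columns $T_1,T_2,\dots$ of $T$ and $S_1,S_2,\dots$ of $S$ (entries read top to bottom), its Specht polynomial is $\mathrm{sp}_{(T,S)}(\mathbf{x})=\prod_i\Delta_{T_i}(\mathbf{x}^2)\prod_j\Delta_{S_j}(\mathbf{x}^2)\prod_{k\in S}x_k\in\mathbb{K}[x_1,\dots,x_n]$, where $\mathbf{x}^2=(x_1^2,\dots,x_n^2)$ and $k\in S$ means $k$ is an entry of $S$. The $B_n$-Specht ideal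 $I_{(\lambda,\mu)}$ is the ideal generated by all $\mathrm{sp}_{(T,S)}$ with $(T,S)$ of shape $(\lambda,\mu)$, and $V_{(\lambda,\mu)}=\{z\in\mathbb{K}^n: f(z)=0\ \forall f\in I_{(\lambda,\mu)}\}$. Bidominance: $(\vartheta,\omega)\unlhd(\lambda,\mu)$ iff for every integer $k\ge1$, $\sum_{j=1}^k(\vartheta_j+\omega_j)\le\sum_{j=1}^k(\lambda_j+\mu_j)$ and $\sum_{j=1}^{k-1}(\vartheta_j+\omega_j)+\vartheta_k\le\sum_{j=1}^{k-1}(\lambda_j+\mu_j)+\lambda_k$. *)

(* Defs.v *)
From mathcomp Require Import all_boot all_algebra.
From mathcomp Require Import mpoly.

Set Implicit Arguments.
Unset Strict Implicit.
Unset Printing Implicit Defensive.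

Import GRing.Theory.
Local Open Scope ring_scope.

(* Partitions are plain sequences of naturals, trailing zeros being allowed;
   the part of index j (counted from 0) is [nth 0 la j], hence is 0 beyond the
   length. *)
Definition bipartition (n : nat) (bp : seq nat * seq nat) : Prop :=
  [/\ sorted geq bp.1, sorted geq bp.2 & (sumn bp.1 + sumn bp.2 = n)%N].

(* [bidominates lm to] reads: [to] is bidominated by [lm]. Since indices start
   at 0, the instance k below is the usual pair of inequalities for k + 1. *)
Definition bidominates (lm to : seq nat * seq nat) : Prop :=
  forall k : nat,
    (\sum_(j < k.+1) (nth 0 to.1 j + nth 0 to.2 j)
       <= \sum_(j < k.+1) (nth 0 lm.1 j + nth 0 lm.2 j))%N /\
    (\sum_(j < k) (nth 0 to.1 j + nth 0 to.2 j) + nth 0 to.1 k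
       <= \sum_(j < k) (nth 0 lm.1 j + nth 0 lm.2 j) + nth 0 lm.1 k)%N.

(* A tableau is the sequence of its rows; the entries 1, ..., n are represented
   by the elements of 'I_n. *)
Definition bitableau (n : nat) (bp : seq nat * seq nat)
    (T S : seq (seq 'I_n)) : Prop :=
  [/\ shape T = bp.1, shape S = bp.2
    & perm_eq (flatten T ++ flatten S) (enum 'I_n)].

Definition column (A : Type) (T : seq (seq A)) (j : nat) : seq A :=
  pmap (fun r => onth r j) T.

(* The rows of a tableau have non-increasing lengths, so the number of columns
   is the length of the first row. *)
Definition ncolumns (A : Type) (T : seq (seq A)) : nat := head 0%N (shape T).

Definition Delta (n : nat) (R : comNzRingType) (s : seq 'I_n)
    (y : 'I_n -> R) : R :=
  \prod_(j < size s) \prod_(k < size s | (j < k)%N)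
    (y (tnth (in_tuple s) j) - y (tnth (in_tuple s) k)).

Definition specht (K : fieldType) (n : nat) (T S : seq (seq 'I_n))
    : {mpoly K[n]} :=
  let x2 (i : 'I_n) : {mpoly K[n]} := 'X_i ^+ 2 in
  (\prod_(i < ncolumns T) Delta (column T i) x2)
  * (\prod_(j < ncolumns S) Delta (column S j) x2)
  * \prod_(k <- flatten S) 'X_k.

Definition generated_ideal (R : comNzRingType) (G : R -> Prop) (f : R) : Prop :=
  exists s : seq (R * R),
    (forall p, p \in s -> G p.2) /\ f = \sum_(p <- s) p.1 * p.2.

Definition specht_ideal (K : fieldType) (n : nat) (bp : seq nat * seq nat)
    : {mpoly K[n]} -> Prop :=
  generated_ideal (fun f : {mpoly K[n]} =>
    exists T S : seq (seq 'I_n), bitableau bp T S /\ f = specht K T S).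

Definition specht_variety (K : fieldType) (n : nat) (bp : seq nat * seq nat)
    (z : 'I_n -> K) : Prop :=
  forall f : {mpoly K[n]}, specht_ideal bp f -> f.@[z] = 0.

(* Main.v *)
Require Import Defs.
From mathcomp Require Import all_boot all_algebra.
From mathcomp Require Import all_fingroup mpoly zify ring.

(** Interleave the two partitions into the sequence of levels
    la_1, mu_1, la_2, mu_2, ...: bidominance is the dominance order on these
    sequences, and level e consists of the boxes whose variable has exponent e
    in the diagonal term of the Specht polynomial.

    For (1) => (2), if (th, om) is strictly bidominated by (la, mu) then some
    boxes can be moved from the bottom of one column to the bottom of another,
    keeping it bidominated: either a single box goes to a lower level, or a
    run of boxes at levels f+1, f+3, ... goes to the levels f, f+2, ...  Such a
    move enlarges the ideal: for a column B of length q losing k variables to a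
    column A, antisymmetrizing over B the product of the two new Vandermonde
    factors, times a suitable monomial in the moved variables, yields a
    positive multiple of the product of the old ones, because the determinant of a
    family of monic polynomials of degrees 0, ..., q-1 is again the Vandermonde
    determinant.

    For (3) => (1), if the first E+1 levels of (th, om) contain more boxes than
    those of (la, mu), give the boxes of a tableau of shape (th, om) integer
    values depending only on their level, so that the values in each column
    are consecutive.  Its Specht polynomial does not vanish there, but by the
    pigeonhole principle every Specht polynomial of shape (la, mu) does. *)

Set Implicit Arguments.
Unset Strict Implicit.
Unset Printing Implicit Defensive.

Import GRing.Theory.

(** * Antisymmetrization of products of Vandermonde polynomials *)

Section Determinants.
Local Open Scope ring_scope.

(** Expand the inner determinant over permutations t. If t respects [blk], replacing s by t * s
    absorbs the sign of t, and t contributes one full copy of the determinant; every other t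
    contributes 0. *)
Lemma sum_sign_det_block (R : comNzRingType) (q : nat) (blk : rel 'I_q)
    (F : 'I_q -> 'I_q -> R) :
  \sum_(s : 'S_q) (-1) ^+ s * \det (\matrix_(i, j) (F i (s j) *+ blk i j)) =
  \det (\matrix_(i, j) F i j) *+ #|[pred t : 'S_q | [forall i, blk i (t i)]]|.
Proof.
under eq_bigr => s _ do rewrite [\det _]/determinant mulr_sumr.
rewrite exchange_big /= -sumr_const [RHS]big_mkcond /=.
apply: eq_bigr => t _; rewrite !inE.
case: ifPn => [/forallP blkt | /forallPn[i nblk]]; last first.
  by rewrite big1 // => s _; rewrite (bigD1 i) //= mxE (negPf nblk) !(mul0r, mulr0).
rewrite [RHS](reindex_inj (mulgI t)) /=; apply: eq_bigr => s _.
rewrite mulrA odd_permM signr_addb (mulrC ((-1) ^+ t)); congr (_ * _).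
by apply: eq_bigr => i _; rewrite !mxE blkt permM.
Qed.

(** The matrix is the coefficient matrix of [F], which is unitriangular, times the Vandermonde
    matrix. *)
Lemma det_monic_poly (R : comNzRingType) (q : nat) (F : 'I_q -> {poly R})
    (u : 'I_q -> R) :
  (forall i, F i \is monic) -> (forall i, size (F i) = i.+1) ->
  \det (\matrix_(i, j) (F i).[u j]) = \det (Vandermonde q (\row_j u j)).
Proof.
move=> monF szF.
have -> : \matrix_(i, j) (F i).[u j] =
    (\matrix_(i, l < q) (F i)`_l) *m Vandermonde q (\row_j u j).
  apply/matrixP => i j; rewrite !mxE (@horner_coef_wide _ q) ?szF ?ltn_ord //.
  by apply: eq_bigr => l _; rewrite !mxE.
rewrite det_mulmx det_trig; last first.
  by apply/is_trig_mxP => i j ltij; rewrite mxE nth_default // szF.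
rewrite big1 ?mul1r // => i _; rewrite mxE.
by have /monicP := monF i; rewrite /lead_coef szF.
Qed.
End Determinants.

Section DeltaTheory.
Local Open Scope ring_scope.
Variables (n : nat) (R : comNzRingType) (y : 'I_n -> R).
Implicit Types s : seq 'I_n.

Lemma Delta_tuple q (s : q.-tuple 'I_n) :
  Delta s y = \prod_(i < q) \prod_(j < q | (i < j)%N) (y (tnth s i) - y (tnth s j)).
Proof.
case: s => s szs; have eq_q := eqP szs; subst q.
by rewrite (_ : Tuple szs = in_tuple s) //; apply: val_inj.
Qed.

(** The nodes are -y because [Delta] takes earlier minus later, the opposite of the Vandermonde
    convention. *)
Lemma Delta_det q (s : q.-tuple 'I_n) :
  Delta s y = \det (Vandermonde q (\row_i - y (tnth s i))).
Proof.
rewrite Delta_tuple det_Vandermonde; apply: eq_bigr => i _; apply: eq_bigr => j _.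
by rewrite !mxE opprK addrC.
Qed.

Lemma Delta_nil : Delta [::] y = 1.
Proof. by rewrite /Delta big_ord0. Qed.

Lemma Delta_cons a s : Delta (a :: s) y = \prod_(b <- s) (y a - y b) * Delta s y.
Proof.
rewrite (Delta_tuple [tuple of a :: in_tuple s]) big_ord_recl; congr (_ * _).
  rewrite big_mkcond big_ord_recl /= mul1r [RHS]big_tnth.
  by apply: eq_bigr => i _; rewrite tnth0 tnthS.
apply: eq_bigr => i _; rewrite big_mkcond big_ord_recl /= mul1r [RHS]big_mkcond.
by apply: eq_bigr => j _; rewrite !tnthS.
Qed.

Lemma Delta_cat s1 s2 :
  Delta (s1 ++ s2) y =
  Delta s1 y * Delta s2 y * \prod_(b <- s2) \prod_(a <- s1) (y a - y b).
Proof.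
elim: s1 => [|a s1 IH] /=.
  by rewrite Delta_nil mul1r big1 ?mulr1 // => b _; rewrite big_nil.
rewrite !Delta_cons IH big_cat /=.
under [X in _ = _ * X]eq_bigr => b _ do rewrite big_cons.
rewrite big_split /=; set p1 := \prod_(_ <- s1) _; set p2 := \prod_(_ <- s2) _.
set p3 := \prod_(_ <- s2) _.
by rewrite -!mulrA; congr (_ * _); rewrite mulrCA; congr (_ * _); rewrite mulrCA.
Qed.

Section Exchange.
Variables (q1 k : nat) (B : (q1 + k).-tuple 'I_n).

Definition kept (s : 'S_(q1 + k)) : q1.-tuple 'I_n :=
  [tuple tnth B (s (lshift k i)) | i < q1].
Definition moved (s : 'S_(q1 + k)) : k.-tuple 'I_n :=
  [tuple tnth B (s (rshift q1 i)) | i < k].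

Lemma perm_kept_moved (s : 'S_(q1 + k)) : perm_eq (kept s ++ moved s) B.
Proof.
apply/seq.permP => a; rewrite -!sum1_count big_cat /=.
rewrite ![in LHS]big_mkcond [RHS]big_mkcond [RHS]big_tuple.
rewrite [RHS](reindex_inj (@perm_inj _ s)) [RHS]big_split_ord.
by rewrite !big_map [X in (_ + X)%N]big_mkcond /= -!enumT !big_enum.
Qed.

(** Up to the factor [Delta A y], each summand is a signed block diagonal determinant of values of
    monic polynomials of degrees 0, ..., q1 + k - 1 at the nodes -y. By [sum_sign_det_block] the
    signed sum is a multiple of the full determinant, which is [Delta B y]; the multiplicity [N]
    counts the permutations preserving both blocks. *)
Lemma sum_sign_Delta_exchange (A : seq 'I_n) (e : nat) :
  (e + size A = q1)%N ->
  exists2 N : nat, (0 < N)%N &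
  \sum_(s : 'S_(q1 + k)) (-1) ^+ s * (\prod_(j <- moved s) (- y j) ^+ e)
     * (Delta (A ++ moved s) y * Delta (kept s) y) = (Delta A y * Delta B y) *+ N.
Proof.
move=> sizeA; pose u i := - y (tnth B i).
pose blk (i j : 'I_(q1 + k)) := (i < q1)%N == (j < q1)%N.
pose N := #|[pred t : 'S_(q1 + k) | [forall i, blk i (t i)]]|.
exists N; first by apply/card_gt0P; exists 1%g; rewrite inE; apply/forallP => i; rewrite perm1 /blk.
pose g : {poly R} := \prod_(a <- A) ('X - (- y a)%:P).
have g_monic : g \is monic by apply: monic_prod_XsubC.
have size_g : size g = (size A).+1 by rewrite size_prod_XsubC.
(* In the second block the degree is e + |A| + (i - q1) = i, thanks to the hypothesis on [e]. *)
pose F (i : 'I_(q1 + k)) : {poly R} :=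
  if (i < q1)%N then 'X^i else 'X^e * g * 'X^(i - q1).
have F_monic i : F i \is monic.
  by rewrite /F; case: ifP => _; rewrite ?monicXn // !monicMr ?monicXn.
have size_F i : size (F i) = i.+1.
  rewrite /F; case: ltnP => [_|le_q1i]; first by rewrite size_polyXn.
  rewrite !size_monicM ?monicMr ?monic_neq0 ?monicXn // size_g !size_polyXn.
  by rewrite !(addnS, addSn) /= sizeA subnKC.
transitivity (Delta A y *
    \sum_(s : 'S_(q1 + k)) (-1) ^+ s *
      \det (\matrix_(i, j) ((F i).[u (s j)] *+ blk i j))).
  rewrite mulr_sumr; apply: eq_bigr => s _.
  pose W i j := (F i).[u (s j)].
  have -> : \matrix_(i, j) (W i j *+ blk i j) =
      block_mx (\matrix_(i < q1, j < q1) W (lshift k i) (lshift k j)) 0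
               0 (\matrix_(i < k, j < k) W (rshift q1 i) (rshift q1 j)).
    apply/matrixP => i j; rewrite -[i]splitK -[j]splitK mxE.
    by case: (split i) (split j) => i' [] j';
      rewrite ?(block_mxEul, block_mxEur, block_mxEdl, block_mxEdr) mxE
              /blk /= ?ltn_ord ?(ltnNge (_ + _)%N) ?leq_addr /=.
  rewrite det_ublock.
  have -> : \matrix_(i < q1, j < q1) W (lshift k i) (lshift k j) =
      Vandermonde q1 (\row_i - y (tnth (kept s) i)).
    apply/matrixP => i j.
    by rewrite !mxE tnth_mktuple /W /F /= ltn_ord hornerXn.
  (* The common factor X^e g leaves a Vandermonde matrix; evaluated at the moved nodes, g yields the
     cross factors of [Delta (A ++ moved s) y]. *)
  have -> : \matrix_(i < k, j < k) W (rshift q1 i) (rshift q1 j) =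
      Vandermonde k (\row_i - y (tnth (moved s) i)) *m
      diag_mx (\row_j ('X^e * g).[- y (tnth (moved s) j)]).
    apply/matrixP => i j; rewrite mul_mx_diag !mxE !tnth_mktuple /W /F /=.
    by rewrite ltnNge leq_addr /= addKn hornerM hornerXn mulrC.
  rewrite det_mulmx det_diag -!Delta_det Delta_cat.
  have -> : \prod_(i < k) (\row_j ('X^e * g).[- y (tnth (moved s) j)]) 0 i =
      \prod_(b <- moved s) (- y b) ^+ e * \prod_(b <- moved s) \prod_(a <- A) (y a - y b).
    rewrite -big_split big_map /= big_enum; apply: eq_bigr => i _.
    rewrite mxE tnth_mktuple hornerM hornerXn horner_prod; congr (_ * _).
    by apply: eq_bigr => a _; rewrite hornerXsubC opprK addrC.
  set p1 := \prod_(b <- _) _; set p2 := \prod_(b <- _) _.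
  set dA := Delta A y; set d1 := Delta _ y; set d2 := Delta _ y.
  set sg := (-1) ^+ s.
  rewrite [RHS]mulrCA -!mulrA; congr (sg * _).
  by rewrite mulrCA; congr (dA * _); rewrite mulrCA [RHS]mulrC -!mulrA; congr (_ * _);
     rewrite mulrC -mulrA.
rewrite -mulrnAr; congr (_ * _).
rewrite (sum_sign_det_block blk (fun i j => (F i).[u j])) det_monic_poly //.
by rewrite Delta_det.
Qed.
End Exchange.
End DeltaTheory.

(** * Ideals generated by a family *)

Section GeneratedIdeal.
Local Open Scope ring_scope.
Variable R : comNzRingType.
Implicit Types (G H : R -> Prop) (f g r : R).

Lemma generated_ideal_gen G g : G g -> generated_ideal G g.
Proof.
move=> Gg; exists [:: (1, g)]; split; last by rewrite big_seq1 mul1r.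
by move=> p; rewrite inE => /eqP->.
Qed.

Lemma generated_idealD G f g :
  generated_ideal G f -> generated_ideal G g -> generated_ideal G (f + g).
Proof.
move=> [s [Gs ->]] [t [Gt ->]]; exists (s ++ t); split; last by rewrite big_cat.
by move=> p; rewrite mem_cat => /orP[/Gs|/Gt].
Qed.

Lemma generated_idealM G r f : generated_ideal G f -> generated_ideal G (r * f).
Proof.
move=> [s [Gs ->]]; exists [seq (r * p.1, p.2) | p <- s]; split.
  by move=> p /mapP[q /Gs Gq ->].
by rewrite big_map mulr_sumr; apply: eq_bigr => p _; rewrite mulrA.
Qed.

Lemma generated_ideal_sum (I : eqType) (t : seq I) (F : I -> R) G :
  (forall i, i \in t -> generated_ideal G (F i)) ->
  generated_ideal G (\sum_(i <- t) F i).
Proof.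
move=> GF; rewrite big_seq; elim/big_rec: _ => [|i f ti Gf].
  by exists [::]; rewrite big_nil.
by apply: generated_idealD => //; apply: GF.
Qed.

Lemma generated_ideal_sub G H f :
  (forall g, G g -> generated_ideal H g) ->
  generated_ideal G f -> generated_ideal H f.
Proof.
move=> GH [s [Gs ->]]; apply: generated_ideal_sum => p sp.
by apply/generated_idealM/GH/Gs.
Qed.
End GeneratedIdeal.

(** * Exchange of variables between two column polynomials *)

Section ColumnPoly.
Local Open Scope ring_scope.
Variables (K : fieldType) (n : nat).

Definition Xsq (i : 'I_n) : {mpoly K[n]} := 'X_i ^+ 2.

Definition cpoly (b : bool) (s : seq 'I_n) : {mpoly K[n]} :=
  Delta s Xsq * \prod_(i <- s) 'X_i ^+ b.

(** This is [sum_sign_Delta_exchange] in the squared variables, divided by [N], which is where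
    characteristic 0 enters. The inequality says that no moved box reaches a higher level, so that
    the exponents needed to correct the moved variables are nonnegative. *)
Lemma cpoly_exchange (charK0 : [pchar K] =i pred0) (a b : bool)
    (A B : seq 'I_n) (k : nat) :
  (k <= size B)%N -> (a + (size A + k).*2 <= b + (size B).*2)%N ->
  generated_ideal (fun f => exists A' B',
    [/\ size A' = (size A + k)%N, size B' = (size B - k)%N,
        perm_eq (A' ++ B') (A ++ B) & f = cpoly a A' * cpoly b B'])
    (cpoly a A * cpoly b B).
Proof.
move=> le_kB le_ab; pose q1 := (size B - k)%N.
have sizeB : size B = (q1 + k)%N by rewrite subnK.
have le_Aq1 : (size A <= q1)%N by move: (a) (b) le_ab sizeB => [] []; lia.
have sizeBP : size B == (q1 + k)%N by apply/eqP.
pose Bt : (q1 + k).-tuple 'I_n := Tuple sizeBP.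
pose e := (q1 - size A)%N; have sizeA : (e + size A = q1)%N by rewrite subnK.
have [N N_gt0 sumE] := sum_sign_Delta_exchange Xsq Bt sizeA.
have N_neq0 : N%:R != 0 :> K by rewrite (pcharf0P K).1 // -lt0n.
have divN (p : {mpoly K[n]}) : p = N%:R^-1 *: (p *+ N).
  by rewrite -scaler_nat scalerA mulVf ?scale1r.
have le_ae : (a <= b + e.*2)%N by move: (a) (b) le_ab sizeB sizeA => [] []; lia.
(* A moved variable has exponent [a] in its new column, while the exchange identity asks for
   (-x^2)^e x^b; [c] is the quotient. *)
pose c (i : 'I_n) : {mpoly K[n]} := (-1) ^+ e * 'X_i ^+ (b + e.*2 - a).
have cE i : c i * 'X_i ^+ a = (- Xsq i) ^+ e * 'X_i ^+ b.
  rewrite /c -mulrA -exprD subnK // addnC exprD -mul2n exprM mulrA.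
  by congr (_ * _); rewrite [RHS]exprNn.
have -> : cpoly a A * cpoly b B = \sum_(s : 'S_(q1 + k))
    (N%:R^-1 *: ((-1) ^+ s * \prod_(j <- moved Bt s) c j)) *
    (cpoly a (A ++ moved Bt s) * cpoly b (kept Bt s)).
  rewrite [LHS]divN /cpoly mulrACA -[X in _ *: X = _]mulrnAl -[Delta B _]/(Delta Bt _) -sumE.
  rewrite mulr_suml scaler_sumr; apply: eq_bigr => s _.
  rewrite -scalerAl; congr (_ *: _); rewrite -!mulrA; congr (_ * _).
  rewrite big_cat /= -(perm_big _ (perm_kept_moved Bt s)) big_cat /=.
  set DA := Delta _ _; set DB := Delta _ _.
  set p1 := \prod_(i <- A) _; set p2 := \prod_(i <- kept _ _) _.
  transitivity ((\prod_(j <- moved Bt s) ((- Xsq j) ^+ e * 'X_j ^+ b)) * (DA * (DB * (p1 * p2)))).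
    by rewrite big_split /=; ring.
  under eq_bigr => j _ do rewrite -cE.
  by rewrite big_split /=; ring.
apply: generated_ideal_sum => s _; apply/generated_idealM/generated_ideal_gen.
exists (A ++ moved Bt s), (kept Bt s).
split; rewrite ?size_cat ?size_tuple //.
rewrite -catA perm_cat2l perm_catC; exact: perm_kept_moved.
Qed.
End ColumnPoly.

(** * Moving boxes between levels *)

Section Levels.
Implicit Types (c d : nat -> nat) (e f g k : nat).

Definition psum d E := \sum_(e < E) d e.

(** Only levels of equal parity are compared, since they are the rows of the same diagram. *)
Definition level_seq (N : nat) d :=
  (forall e, d e.+2 <= d e) /\ (forall e, N <= e -> d e = 0).

Lemma psumS d E : psum d E.+1 = psum d E + d E.
Proof. by rewrite /psum big_ord_recr. Qed.

Lemma psum0 d : psum d 0 = 0.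
Proof. by rewrite /psum big_ord0. Qed.

Lemma level_seq_leq N d e i : level_seq N d -> d (e + i.*2) <= d e.
Proof.
case=> dS _; elim: i => [|i IH]; first by rewrite addn0.
by rewrite doubleS !addnS; apply: leq_trans (dS _) IH.
Qed.

Lemma psum_stable N d E : level_seq N d -> N <= E -> psum d E = psum d N.
Proof.
case=> _ dN; elim: E => [|E IH]; first by rewrite leqn0 => /eqP->.
rewrite leq_eqVlt => /orP[/eqP->//|leNE].
by rewrite psumS dN // addn0 IH.
Qed.

Definition ladder f k e := [&& f <= e, e < f + k.*2 & odd e == odd f].

Lemma psum_ladder1 f E : psum (ladder f 1) E = (f < E).
Proof.
elim: E => [|E IH]; first by rewrite psum0.
rewrite psumS IH /ladder; lia.
Qed.

(** Two ladders shifted by one level are told apart only by a partial sum that cuts between f + 2i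
    and f + 2i + 1, that is, at E = f + 2i + 1. *)
Lemma psum_ladderS f k E :
  psum (ladder f k) E = psum (ladder f.+1 k) E + ladder f.+1 k E.
Proof.
elim: E => [|E IH]; first by rewrite !psum0.
by rewrite !psumS IH /ladder; lia.
Qed.

(* Moves boxes from the levels g, g+2, ..., g+2(k-1) to f, f+2, ..., f+2(k-1). *)
Definition move d f g k e := d e + ladder f k e - ladder g k e.

(** [adm_raised] puts all arriving boxes in one column, of index d f, and [adm_lowered] makes all
    departing boxes come from one column, of index d g - 1. [adm_top] and [adm_bottom] keep the two
    diagrams partitions. *)
Record admissible d f g k : Prop := Admissible {
  adm_gt0 : 0 < k;
  adm_lt : f < g;
  adm_shape : k = 1 \/ g = f.+1;
  adm_top : f < 2 \/ d f < d (f - 2);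
  adm_raised : forall e, ladder f k e -> d e = d f;
  adm_lowered : forall e, ladder g k e -> d e = d g;
  adm_bottom : d (g + k.*2) < d g
}.

Lemma ladder_disjoint d f g k e :
  admissible d f g k -> ladder f k e -> ladder g k e -> False.
Proof. by case=> _ lt_fg [->|->] _ _ _ _; rewrite /ladder; lia. Qed.

Lemma moveE d f g k e :
  admissible d f g k -> move d f g k e + ladder g k e = d e + ladder f k e.
Proof.
move=> adm; rewrite /move subnK //; case: (boolP (ladder g k e)) => // Ge.
rewrite (adm_lowered adm Ge); have := adm_bottom adm; lia.
Qed.

Lemma psum_moveE d f g k E : admissible d f g k ->
  psum (move d f g k) E + psum (ladder g k) E = psum d E + psum (ladder f k) E.
Proof.
move=> adm; elim: E => [|E IH]; first by rewrite !psum0.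
rewrite !psumS; have := moveE E adm; lia.
Qed.

(** The last level losing a box, g + 2(k - 1), is nonempty, hence smaller than [N]. *)
Lemma admissible_bound N d f g k :
  level_seq N d -> admissible d f g k -> g + k.*2 <= N.+1.
Proof.
move=> [_ dN] adm; rewrite leqNgt; apply/negP => ltN.
have Ge : ladder g k (g + k.-1.*2).
  by rewrite /ladder; have := adm_gt0 adm; lia.
have := adm_bottom adm; rewrite -(adm_lowered adm Ge) (dN (g + k.-1.*2)) //.
have := adm_gt0 adm; lia.
Qed.

Lemma move_level_seq N d f g k :
  level_seq N d -> admissible d f g k -> level_seq N (move d f g k).
Proof.
move=> lvd adm; have [dS dN] := lvd; split=> e.
  have := moveE e adm; have := moveE e.+2 adm; have := dS e.
  have lt_fg := adm_lt adm; have k_gt0 := adm_gt0 adm.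
  (* Monotonicity can break only just above the raised ladder or just below the lowered one. *)
  have F1 : ladder f k e.+2 -> ~~ ladder f k e -> e.+2 = f by rewrite /ladder; lia.
  have G1 : ladder g k e -> ~~ ladder g k e.+2 -> e.+2 = g + k.*2.
    by rewrite /ladder; lia.
  have F2 : e.+2 = f -> d e.+2 < d e.
    move=> eq_f; have := adm_top adm; rewrite -eq_f; case=> //.
    by rewrite subn2.
  have G2 : ladder g k e -> e.+2 = g + k.*2 -> d e.+2 < d e.
    by move=> Ge ->; rewrite (adm_lowered adm Ge); exact: adm_bottom adm.
  case: (ladder f k e) (ladder f k e.+2) (ladder g k e) (ladder g k e.+2)
    F1 G1 F2 G2 => [] [] [] [] /=; lia.
move=> leNe; rewrite /move dN // /ladder.
have := admissible_bound lvd adm; have := adm_lt adm; lia.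
Qed.

(** Let [E0] be the first level where d and c differ, and [X] the first later level after which the
    partial sums agree again. If some row of d in levels E0 + 1, ..., X is longer than the next row
    of its diagram, its last box can go to [E0], because the partial sums in between have room.
    Otherwise X = E0 + 1, and a run of boxes moves up by one level. *)
Lemma exists_move N c d :
  level_seq N c -> level_seq N d -> psum d N = psum c N ->
  (forall E, psum d E <= psum c E) -> (exists e, d e != c e) ->
  exists f g k, admissible d f g k /\ forall E, psum (move d f g k) E <= psum c E.
Proof.
move=> lvc lvd eqN dom ex; have [cS cN] := lvc; have [dS dN] := lvd.
case: (ex_minnP ex) => E0 neqE0 minE0.
have eq_lt e : e < E0 -> d e = c e.
  by move=> lt; apply/eqP; apply: contraTT lt => /minE0; rewrite -leqNgt.
have eqE0 : psum d E0 = psum c E0 by apply: eq_bigr => e _; apply: eq_lt.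
have ltE0 : d E0 < c E0.
  by move: (dom E0.+1) neqE0; rewrite !psumS eqE0; lia.
have topE0 : E0 < 2 \/ d E0 < d (E0 - 2).
  case: E0 ltE0 eq_lt {neqE0 minE0 eqE0} => [|[|e]] ltE0 eq_lt; [by left | by left | right].
  rewrite subn2 /= (eq_lt e); last lia.
  exact: leq_trans ltE0 (cS e).
(* Beyond [N] both partial sums equal the common total. *)
have exX : exists x, (E0 < x) && (psum d x.+1 == psum c x.+1).
  exists (maxn N E0.+1); rewrite leq_max ltnSn orbT /=.
  rewrite (psum_stable lvd) ?(psum_stable lvc) ?eqN //; lia.
case: (ex_minnP exX) => X /andP[ltE0X /eqP eqX] minX.
have strict x : E0 <= x -> x < X -> psum d x.+1 < psum c x.+1.
  move=> leE0x ltxX; rewrite ltn_neqAle dom andbT.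
  case: (ltngtP E0 x) leE0x => // [lt|eqx] _; last by rewrite -eqx !psumS; move: eqE0 ltE0; lia.
  by apply: contraTN ltxX => eqx; rewrite -leqNgt minX // lt.
case: (boolP [exists e : 'I_X.+1, (E0 < e) && (d e.+2 < d e)]) => [/existsP[e]|].
  move=> /andP[ltE0e drop]; have leX := ltn_ord e.
  have adm : admissible d E0 e 1.
    split=> //; first by left.
    - by move=> i; rewrite /ladder => Fi; congr d; lia.
    - by move=> i; rewrite /ladder => Fi; congr d; lia.
    by rewrite doubleS double0 addn2.
  exists E0, e, 1; split=> // E; have := psum_moveE E adm; rewrite !psum_ladder1.
  have := dom E; case: E => [|x]; first by rewrite !psum0.
  have := @strict x; lia.
move=> /existsPn noDrop.
have const e : E0 < e -> e <= X -> d e.+2 = d e.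
  move=> lt le; have := noDrop (Ordinal (le : e < X.+1)) => /=.
  by have := dS e; lia.
(* Otherwise d exceeds c in total over levels X - 1 and X; d repeats these two values at X + 1 and X
   + 2 while c does not increase, so dominance would fail at X + 3. *)
have eqX1 : X = E0.+1.
  apply/eqP; rewrite eqn_leq ltE0X andbT leqNgt; apply/negP => gtX.
  have -/subnK eqx : 2 <= X by lia.
  pose x := X - 2; move: eqX (strict x); rewrite -eqx addn2 -/x => eqX'.
  have := const x.+1; have := const x.+2; have := dom x.+3.+2; move: eqX'.
  rewrite !psumS; have := cS x.+1; have := cS x.+2; lia.
subst X; have dX_gt : c E0.+1 < d E0.+1.
  by have := strict E0; move: eqX; rewrite !(psumS _ E0.+1); lia.
(* [k1] ends the run of rows of length d (E0 + 1) starting at level E0 + 1; below, [i0] is the first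
   index where the target rows have the length of row E0 + 2 k1. The boxes moved are those with i0
   <= i <= k1. *)
have exk : exists i, d (E0.+1 + i.+1.*2) != d E0.+1.
  by exists N; rewrite dN; lia.
case: (ex_minnP exk) => k1 neqk1 mink1.
have dXi i : i <= k1 -> d (E0.+1 + i.*2) = d E0.+1.
  case: i => [|i] leik; first by rewrite addn0.
  by apply/eqP; apply: contraTT leik => /mink1; rewrite -ltnNge ltnS.
(* On this run d still exceeds c at level E0 + 1 + 2i, so dominance one step later forces a strict
   inequality here. *)
have strict2 i : i <= k1 -> psum d (E0 + i.*2).+1 < psum c (E0 + i.*2).+1.
  move=> lei; have := dom (E0.+1 + i.*2).+1; rewrite 2!psumS dXi //.
  have := level_seq_leq E0.+1 i lvc; rewrite addSn; lia.
have exi : exists i, d (E0 + i.*2) == d (E0 + k1.*2) by exists k1.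
case: (ex_minnP exi) => i0 /eqP eqi0 mini0.
have lei0 : i0 <= k1 by apply: mini0.
pose k := (k1 - i0).+1.
have adm : admissible d (E0 + i0.*2) (E0 + i0.*2).+1 k.
  split=> //; first by right.
  - case: i0 eqi0 mini0 {lei0 k} => [|i] eqi0 mini0; first by rewrite addn0.
    right; rewrite eqi0 doubleS !addnS !subSS subn0.
    rewrite ltn_neqAle; apply/andP; split.
      by apply/negP => /eqP eqi; have := mini0 i; rewrite eqi eqxx ltnn => /(_ isT).
    by rewrite -eqi0 doubleS !addnS dS.
  - move=> e; rewrite /ladder => He; pose i := (e - (E0 + i0.*2))./2.
    have -> : e = E0 + i0.*2 + i.*2 by rewrite /i; lia.
    apply/eqP; rewrite eqn_leq (level_seq_leq _ _ lvd) /= eqi0.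
    have -> : E0 + k1.*2 = E0 + i0.*2 + i.*2 + (k1 - i0 - i).*2.
      by rewrite /i; move: He; rewrite /k; lia.
    exact: level_seq_leq lvd.
  - move=> e; rewrite /ladder => He; pose i := (e - E0.+1)./2.
    have -> : e = E0.+1 + i.*2 by rewrite /i; lia.
    by rewrite -addSn !dXi //; rewrite /i; move: He; rewrite /k; lia.
  rewrite -addSn dXi // (_ : _ + k.*2 = E0.+1 + k1.+1.*2); last by rewrite /k; lia.
  by rewrite ltn_neqAle neqk1 (level_seq_leq _ _ lvd).
exists (E0 + i0.*2), (E0 + i0.*2).+1, k; split=> // E.
have := psum_moveE E adm; rewrite (psum_ladderS (E0 + _) k).
case: (boolP (ladder _ k E)) => [|_]; last by have := dom E; lia.
rewrite {1}/ladder => HE; pose i := (E - E0.+1)./2.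
have lei : i <= k1 by rewrite /i; move: HE; rewrite /k; lia.
have eqE : (E0 + i.*2).+1 = E by rewrite /i; lia.
by move: (strict2 i lei); rewrite eqE; lia.
Qed.

(** Induction on the total gap between the partial sums, which every move decreases, strictly at f +
    1. *)
Lemma move_ind N c (Q : (nat -> nat) -> Prop) :
  level_seq N c -> (forall d, d =1 c -> Q d) ->
  (forall d f g k, level_seq N d -> psum d N = psum c N -> admissible d f g k ->
     Q (move d f g k) -> Q d) ->
  forall d, level_seq N d -> psum d N = psum c N ->
    (forall E, psum d E <= psum c E) -> Q d.
Proof.
move=> lvc Qc Qmove d.
pose gap d := \sum_(E < N.+1) (psum c E - psum d E).
elim: (gap d).+1 {-2}d (ltnSn (gap d)) => // m IH {}d ltm lvd eqN dom.
case: (boolP [forall e : 'I_N, d e == c e]) => [/forallP eqdc | /forallPn[e neqe]].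
  apply: Qc => e; case: (ltnP e N) => [lteN|leNe]; last by rewrite lvd.2 ?lvc.2.
  exact/eqP/(eqdc (Ordinal lteN)).
have [|f [g [k [adm dom']]]] := exists_move lvc lvd eqN dom; first by exists e.
have lvd' := move_level_seq lvd adm.
have bnd := admissible_bound lvd adm; have lt_fg := adm_lt adm; have k_gt0 := adm_gt0 adm.
have psum_le E : psum d E + (E == f.+1) <= psum (move d f g k) E.
  have := psum_moveE E adm; case: (adm_shape adm) => [->|->].
    by rewrite !psum_ladder1; lia.
  by rewrite (psum_ladderS f k) /ladder; lia.
apply: (Qmove d f g k) => //; apply: IH => //.
  suff: gap (move d f g k) < gap d by move: ltm; lia.
  rewrite /gap.
  have ltf : f.+1 < N.+1 by lia.
  rewrite (bigD1 (Ordinal ltf)) //= [X in _ < X](bigD1 (Ordinal ltf)) //=.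
  rewrite -addSn leq_add //.
    by have := psum_le f.+1; have := dom' f.+1; rewrite eqxx; lia.
  by apply: leq_sum => E _; have := psum_le E; lia.
apply/eqP; rewrite eqn_leq dom' -eqN /=; have := psum_le N; lia.
Qed.
End Levels.

(** * Systems of columns *)

Section Heights.
Implicit Types (d : nat -> nat) (b : bool).

Lemma sum_ltn n m : \sum_(j < n) (j < m) = minn n m.
Proof.
elim: n => [|n IH]; first by rewrite big_ord0 min0n.
by rewrite big_ord_recr /= IH; lia.
Qed.

Lemma ltn_sum_decreasing (p : nat -> bool) M l :
  (forall i, p i.+1 -> p i) -> l < M -> (l < \sum_(i < M) p i) = p l.
Proof.
move=> dec; have dec' i j : i <= j -> p j -> p i.
  by elim: j => [|j IH]; rewrite leq_eqVlt => /orP[/eqP->|] // /IH {}IH /dec.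
elim: M l => // M IH l; rewrite big_ord_recr /= ltnS => lelM.
case: (boolP (p M)) => pM.
  have -> : \sum_(i < M) p i = M.
    rewrite -[RHS]card_ord -sum1_card; apply: eq_bigr => i _.
    by rewrite (dec' i M) // ltnW.
  by rewrite addn1 ltnS lelM (dec' l M).
rewrite addn0; case: (ltngtP l M) lelM => // [ltlM|->] _; first exact: IH.
rewrite (negPf pM); apply/negbTE; rewrite -leqNgt.
rewrite -[X in _ <= X]card_ord -sum1_card; apply: leq_sum => i _; exact: leq_b1.
Qed.

(* Length of column j of the first (b = false) or second (b = true) tableau whose
   levels are given by d, levels beyond M.*2 being empty. *)
Definition height M d b j := \sum_(l < M) (j < d (b + l.*2)).

Lemma eq_height M d d' b j : d =1 d' -> height M d b j = height M d' b j.
Proof. by move=> eqd; apply: eq_bigr => l _; rewrite eqd. Qed.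

(** Conjugation of partitions: both sides say that box (l, j) belongs to diagram [b]. *)
Lemma ltn_height M d b j l :
  level_seq M.*2 d -> (l < height M d b j) = (j < d (b + l.*2)).
Proof.
move=> [dS dM]; case: (ltnP l M) => [ltlM|leMl].
  rewrite (@ltn_sum_decreasing (fun i => j < d (b + i.*2))) // => i.
  by move/leq_trans; apply; rewrite doubleS !addnS dS.
rewrite (dM (b + l.*2)) ?ltn0; last lia.
apply/negbTE; rewrite -leqNgt; apply: leq_trans leMl.
rewrite -[X in _ <= X]card_ord -sum1_card; apply: leq_sum => i _; exact: leq_b1.
Qed.

Lemma heightP M d b j p : level_seq M.*2 d ->
  (forall l, (j < d (b + l.*2)) = (l < p)) -> height M d b j = p.
Proof.
move=> lvd dE; have hE l := ltn_height b j l lvd.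
case: (ltngtP (height M d b j) p) => // lt.
  by have := hE (height M d b j); rewrite dE lt ltnn.
by have := hE p; rewrite dE lt ltnn.
Qed.

Lemma height_le M d b j k : j <= k -> height M d b k <= height M d b j.
Proof.
move=> lejk; apply: leq_sum => l _.
by case: (ltnP k) => // /(leq_ltn_trans lejk)->.
Qed.

Lemma sum_ladder M f k b :
  \sum_(l < M) ladder f k (b + l.*2) = (odd f == b) * minn (M - f./2) k.
Proof.
elim: M => [|M IH]; first by rewrite big_ord0 sub0n min0n muln0.
rewrite big_ord_recr /= IH /ladder; case: b {IH} => /=; lia.
Qed.

(** All rows of a ladder have the same length, so their new, or lost, last boxes lie in a single
    column. *)
Lemma height_move M d f g k b j :
  level_seq M.*2 d -> admissible d f g k ->
  height M (move d f g k) b j + (b == odd g) * (j == (d g).-1) * k =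
  height M d b j + (b == odd f) * (j == d f) * k.
Proof.
move=> lvd adm; have bnd := admissible_bound lvd adm.
have lt_fg := adm_lt adm; have k_gt0 := adm_gt0 adm; have dg_gt := adm_bottom adm.
have -> : (b == odd f) * (j == d f) * k = \sum_(l < M) ladder f k (b + l.*2) * (j == d f).
  by rewrite -big_distrl /= sum_ladder eq_sym mulnAC; congr (_ * _ * _); lia.
have -> : (b == odd g) * (j == (d g).-1) * k =
    \sum_(l < M) ladder g k (b + l.*2) * (j == (d g).-1).
  by rewrite -big_distrl /= sum_ladder eq_sym mulnAC; congr (_ * _ * _); lia.
rewrite /height -!big_split; apply: eq_bigr => l _ /=.
have := moveE (b + l.*2) adm; have := @ladder_disjoint d f g k (b + l.*2) adm.
have := @adm_raised _ _ _ _ adm (b + l.*2); have := @adm_lowered _ _ _ _ adm (b + l.*2).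
move: (ladder f _ _) (ladder g _ _) => [] [] /=; lia.
Qed.

Lemma psum_parity d E :
  psum d E = \sum_(l < uphalf E) d (false + l.*2) + \sum_(l < E./2) d (true + l.*2).
Proof.
elim: E => [|E IH]; first by rewrite psum0 !big_ord0.
rewrite psumS IH /= -/uphalf; case: (boolP (odd E)) => oddE.
  have -> : uphalf E = (E./2).+1 by lia.
  rewrite [X in _ = _ + X]big_ord_recr /= -!addnA; congr (_ + (_ + d _)); lia.
have -> : uphalf E = E./2 by lia.
rewrite [X in _ = X + _]big_ord_recr /= addnAC; congr (_ + d _ + _); lia.
Qed.

Lemma leq_psum d e E : e < E -> d e <= psum d E.
Proof. by move=> lt; rewrite /psum (bigD1 (Ordinal lt)) //= leq_addr. Qed.

(** Double counting of the boxes at levels below [E]: [k b] is the number of such levels of parity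
    [b], and each column meets its first [k b] rows. *)
Lemma sum_minn_height n M d (E : nat) (k : bool -> nat) :
  level_seq M.*2 d -> psum d M.*2 <= n -> (forall b, k b = (E.+1 - b)./2) ->
  \sum_(x : bool * 'I_n) minn (height M d x.1 x.2) (k x.1) = psum d E.
Proof.
move=> lvd le_n kE.
have le_d e : d e <= n.
  case: (ltnP e M.*2) => [lt|le]; last by rewrite lvd.2.
  exact: leq_trans (leq_psum _ lt) le_n.
have sum_b b : \sum_(j < n) minn (height M d b j) (k b) = \sum_(l < k b) d (b + l.*2).
  under eq_bigr => j _ do rewrite minnC -sum_ltn.
  rewrite exchange_big; apply: eq_bigr => l _ /=.
  under eq_bigr => j _ do rewrite ltn_height //.
  by rewrite sum_ltn; apply/minn_idPr.
rewrite -(pair_bigA _ (fun b (j : 'I_n) => minn (height M d b j) (k b))) /=.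
by rewrite big_bool /= !sum_b addnC psum_parity !kE subn0 subn1.
Qed.
End Heights.

Section ColumnSystem.
Variables (K : fieldType) (n : nat).

(** Specht polynomials depend only on columns, so rows are forgotten. Each tableau gets n columns,
    possibly empty, so that a move changes two values of [C] and never its index type. *)
Definition colsys M d (C : bool * 'I_n -> seq 'I_n) :=
  (forall x, size (C x) = height M d x.1 x.2) /\
  (forall i, \sum_x count_mem i (C x) = 1).

Definition colsys_poly (C : bool * 'I_n -> seq 'I_n) : {mpoly K[n]} :=
  (\prod_x cpoly K x.1 (C x))%R.

Definition colsys_gen M d (h : {mpoly K[n]}) :=
  exists C, colsys M d C /\ h = colsys_poly C.

Lemma eq_colsys M d d' C : d =1 d' -> colsys M d C -> colsys M d' C.
Proof.
by move=> eqd [szC cntC]; split=> // x; rewrite szC; apply: eq_height.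
Qed.

Lemma sum_colsys M d C (F : 'I_n -> nat) : colsys M d C ->
  \sum_i F i = \sum_x \sum_(i <- C x) F i.
Proof.
case=> _ cntC; transitivity (\sum_i \sum_x count_mem i (C x) * F i).
  by apply: eq_bigr => i _; rewrite -big_distrl /= cntC mul1n.
rewrite exchange_big; apply: eq_bigr => x _ /=; elim: (C x) => [|i s IH].
  by rewrite big_nil big1.
rewrite big_cons -IH.
under eq_bigr => j _ do rewrite /= mulnDl.
rewrite big_split /=; congr (_ + _); rewrite (bigD1 i) //= eqxx mul1n.
by rewrite big1 ?addn0 // => j; rewrite eq_sym => /negPf->.
Qed.

(** Only the receiving column [Y] and the losing column [X] change; [cpoly_exchange] applies to
    them, and the product of the others is a common factor. *)
Lemma colsys_move (charK0 : [pchar K]%R =i pred0) M d f g k C :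
  level_seq M.*2 d -> psum d M.*2 = n -> admissible d f g k -> colsys M d C ->
  generated_ideal (colsys_gen M (move d f g k)) (colsys_poly C).
Proof.
move=> lvd sum_d adm [szC cntC]; have bnd := admissible_bound lvd adm.
have lt_fg := adm_lt adm; have k_gt0 := adm_gt0 adm; have dg_gt := adm_bottom adm.
(* Since d g > 0, this bounds both column indices by n. *)
have dfg_n : d f + d g <= n.
  have ltf : f < M.*2 by lia.
  have ltg : g < M.*2 by lia.
  rewrite -sum_d /psum (bigD1 (Ordinal ltf)) //= leq_add2l.
  by rewrite (bigD1 (Ordinal ltg)) ?leq_addr // -val_eqE /= neq_ltn lt_fg orbT.
have lt_df : d f < n by lia.
have lt_dg : (d g).-1 < n by lia.
pose Y : bool * 'I_n := (odd f, Ordinal lt_df).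
pose X : bool * 'I_n := (odd g, Ordinal lt_dg).
have neqXY : X != Y.
  rewrite xpair_eqE -val_eqE /=; case: eqP => //= odd_gf.
  have := adm_shape adm; have := @level_seq_leq _ d f (g - f)./2 lvd.
  have -> : f + (g - f)./2.*2 = g by lia.
  by lia.
have fE : f = odd f + f./2.*2 by rewrite odd_double_half.
have gE : g = odd g + g./2.*2 by rewrite odd_double_half.
have mono b l l' : l <= l' -> d (b + l'.*2) <= d (b + l.*2).
  by move/subnKC <-; rewrite doubleD addnA; apply: level_seq_leq lvd.
(* By [adm_top], the rows of this tableau longer than d f are exactly those above level f. *)
have szA : size (C Y) = f./2.
  rewrite szC; apply: heightP => // l /=; case: (ltnP l f./2) => [ltl | lel].
    have := mono (odd f) l (f./2 - 1); have := adm_top adm.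
    have -> : odd f + (f./2 - 1).*2 = f - 2 by lia.
    by move: ltl; lia.
  by apply/negbTE; rewrite -leqNgt {2}fE mono.
have szB : size (C X) = g./2 + k.
  rewrite szC; apply: heightP => // l /=; case: (ltnP l (g./2 + k)) => [ltl | lel].
    have := mono (odd g) l (g./2 + k.-1); have Ge : ladder g k (odd g + (g./2 + k.-1).*2).
      by rewrite /ladder; lia.
    by rewrite (adm_lowered adm Ge); lia.
  apply/negbTE; rewrite -leqNgt; have := mono (odd g) _ _ lel.
  by rewrite doubleD addnA -gE; lia.
have le_kB : k <= size (C X) by rewrite szB leq_addl.
have le_ab : odd f + (size (C Y) + k).*2 <= odd g + (size (C X)).*2.
  by rewrite szA szB; lia.
have := cpoly_exchange charK0 le_kB le_ab.
rewrite /colsys_poly (bigD1 Y) //= (bigD1 X) //= mulrA.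
set r := (\prod_(_ | _) _)%R => -[s [Gs ->]].
rewrite mulrC mulr_sumr; apply: generated_ideal_sum => p sp; rewrite mulrCA.
apply/generated_idealM/generated_ideal_gen.
have [A' [B' [szA' szB' perm ->]]] := Gs p sp.
exists (fun x => if x == Y then A' else if x == X then B' else C x).
split; last first.
  rewrite /colsys_poly [RHS](bigD1 Y) //= eqxx [in RHS](bigD1 X) //= eqxx (negPf neqXY).
  rewrite [RHS]mulrA [RHS]mulrC; congr (_ * _)%R.
  by apply: eq_bigr => x /andP[/negPf-> /negPf->].
split=> [x|i].
  have := height_move x.1 x.2 lvd adm; case: (eqVneq x Y) => [->|neqY].
    move: neqXY; rewrite szA' szC xpair_eqE -val_eqE /= !eqxx.
    by rewrite (eq_sym (odd g)) (eq_sym (d g).-1); case: (_ == _) (_ == _) => [] [] //=; lia.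
  move: neqY; case: (eqVneq x X) => [-> _|neqX neqY].
    move: neqXY; rewrite szB' szC xpair_eqE -val_eqE /= !eqxx.
    by case: (_ == _) (_ == _) => [] [] //=; lia.
  move: neqX neqY; rewrite szC; case: x => b j; rewrite !xpair_eqE -!val_eqE /=.
  by do 4!case: (_ == _) => //=; lia.
rewrite -(cntC i) (bigD1 Y) //= eqxx (bigD1 X) //= eqxx (negPf neqXY).
rewrite [RHS](bigD1 Y) //= [in RHS](bigD1 X) //= !addnA -!count_cat.
congr (_ + _); first exact/seq.permP.
by apply: eq_bigr => x /andP[/negPf-> /negPf->].
Qed.

Lemma colsys_dominated (charK0 : [pchar K]%R =i pred0) M c d :
  level_seq M.*2 c -> level_seq M.*2 d -> psum c M.*2 = n -> psum d M.*2 = n ->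
  (forall E, psum d E <= psum c E) ->
  forall C, colsys M d C -> generated_ideal (colsys_gen M c) (colsys_poly C).
Proof.
move=> lvc lvd sum_c sum_d dom; rewrite -sum_c in sum_d.
pose Q d := forall C, colsys M d C -> generated_ideal (colsys_gen M c) (colsys_poly C).
apply: (move_ind (Q := Q) lvc _ _ lvd sum_d dom) => {d lvd sum_d dom}.
  move=> d eqdc C colC; apply: generated_ideal_gen.
  by exists C; split=> //; apply: eq_colsys colC.
move=> d f g k lvd sum_d adm Qm C colC; rewrite sum_c in sum_d.
apply: generated_ideal_sub (colsys_move charK0 lvd sum_d adm colC) => h [C' [colC' ->]].
exact: Qm.
Qed.
End ColumnSystem.

(** * Tableaux and their columns *)

Section Columns.
Variable A : Type.
Implicit Types (T U : seq (seq A)) (s : seq A).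

Lemma pmap_onth s m : size s <= m -> pmap (onth s) (iota 0 m) = s.
Proof.
elim: s m => [|x s IH] [|m] //=; last first.
  move/IH => {2}<-; rewrite -[1]addn0 iotaDl; congr (_ :: _).
  by elim: (iota 0 m) => //= i t ->.
by move=> _; elim: (iota 1 m) => //= i t ->; case: i.
Qed.

Lemma size_column T j : size (column T j) = \sum_(p <- shape T) (j < p).
Proof.
elim: T => [|r T IH]; first by rewrite big_nil.
by rewrite /= big_cons -IH /column /= -onthTE; case: onth.
Qed.

Lemma count_flatten_column (a : pred A) T m :
  all (fun r => size r <= m) T ->
  count a (flatten T) = \sum_(j < m) count a (column T j).
Proof.
elim: T => [|r T IH] /=; first by rewrite big1.
case/andP => le_rm /IH {}IH; rewrite count_cat IH.
transitivity (\sum_(j < m) (oapp a false (onth r j) + count a (column T j))).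
  rewrite big_split /=; congr (_ + _).
  elim: r m le_rm {IH} => [|x r IH] [|m] //= le_rm.
  - by rewrite big_ord0.
  - by rewrite big1 // => i _; case: (i : nat).
  - by rewrite big_ord_recl (IH m).
by apply: eq_bigr => j _; rewrite {2}/column /=; case: (onth r j).
Qed.

(** Once a row is too short to meet column [l], so are all later rows; hence [pmap] drops only a
    tail and shifts no index. *)
Lemma onth_column U l j : sorted geq (shape U) ->
  onth (column U l) j = obind (fun u => onth u l) (onth U j).
Proof.
elim: U j => [|u U IH] j; first by case: j.
rewrite /= => sortU; rewrite /column /=.
have IHl j' : onth (column U l) j' = obind (fun u => onth u l) (onth U j').
  by apply: IH; apply: path_sorted sortU.
case ul: (onth u l) (onthTE u l) => [x|] /=; first by case: j => [|j] //= _; apply: IHl.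
move=> /esym/negbT; rewrite -leqNgt => le_ul.
have shortU j' : onth (column U l) j' = None.
  rewrite IHl; case Ur: (onth U j') => [r|] //=; apply: onth_default.
  apply: leq_trans le_ul; have ltj' : j' < size U by rewrite -onthTE Ur.
  have := allP (order_path_min (rev_trans leq_trans) sortU) (size r).
  apply; have <- : nth r U j' = r by rewrite -odflt_onth Ur.
  rewrite -(nth_map r 0) //.
  by apply: mem_nth; rewrite size_map.
by rewrite [LHS](shortU j); case: j => [|j] /=; rewrite ?ul // -IHl shortU.
Qed.

(** Transposing twice gives the tableau back; this serves to build a tableau with prescribed
    columns. *)
Lemma columnK U m j : sorted geq (shape U) -> all (fun u => size u <= m) U ->
  column (mkseq (column U) m) j = nth [::] U j.
Proof.
move=> sortU leU; rewrite {1}/column.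
have -> : pmap (fun r => onth r j) (mkseq (column U) m) = pmap (onth (nth [::] U j)) (iota 0 m).
  rewrite /mkseq; elim: (iota 0 m) => //= l t ->.
  rewrite onth_column //; case Uj: (onth U j) => [u|] /=.
    by rewrite -odflt_onth Uj.
  by rewrite nth_default ?onth0n // -onthNE Uj.
apply: pmap_onth; case: (ltnP j (size U)) => [lt|le]; last by rewrite nth_default.
exact: (all_nthP [::] leU).
Qed.
End Columns.

Lemma sum_nth (F : nat -> nat) (s : seq nat) M :
  F 0 = 0 -> size s <= M -> \sum_(p <- s) F p = \sum_(l < M) F (nth 0 s l).
Proof.
move=> F0; elim: s M => [|p s IH] [|M] //= leM; rewrite ?big_nil ?big_ord0 //.
  by rewrite big1 // => l _; rewrite nth_nil.
by rewrite big_cons big_ord_recl /= (IH M).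
Qed.

(** * Bipartitions as level sequences *)

Definition levels (bp : seq nat * seq nat) (e : nat) : nat :=
  nth 0 (if odd e then bp.2 else bp.1) e./2.

Definition part (bp : seq nat * seq nat) (b : bool) := if b then bp.2 else bp.1.

Lemma levels_part bp (b : bool) l : levels bp (b + l.*2) = nth 0 (part bp b) l.
Proof.
by rewrite /levels oddD odd_double addbF oddb half_bit_double.
Qed.

Section Bipartition.
Variables (n M : nat) (bp : seq nat * seq nat).
Hypotheses (bp_n : bipartition n bp) (leM : forall b, size (part bp b) <= M).

Lemma level_seq_levels : level_seq M.*2 (levels bp).
Proof.
have [s1 s2 _] := bp_n.
have sort_part b : sorted geq (part bp b) by case: b.
split=> e; rewrite -(odd_double_half e).
  rewrite -!addnS -doubleS !levels_part; set s := part bp _.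
  case: (ltnP e./2.+1 (size s)) => [lt|le]; last by rewrite (nth_default _ le).
  by apply: (sorted_leq_nth (rev_trans leq_trans) leqnn 0 (sort_part _)); rewrite ?inE // ltnW.
move=> leMe; rewrite levels_part nth_default //; apply: leq_trans (leM _) _.
by lia.
Qed.

Lemma psum_levels : psum (levels bp) M.*2 = n.
Proof.
have [_ _ <-] := bp_n.
have half b : sumn (part bp b) = \sum_(l < M) levels bp (b + l.*2).
  rewrite sumnE (sum_nth (F := id) _ (leM b)) //.
  by apply: eq_bigr => l _; rewrite levels_part.
by rewrite psum_parity uphalf_double doubleK -(half false) -(half true).
Qed.

Lemma height_levels b j : height M (levels bp) b j = \sum_(p <- part bp b) (j < p).
Proof.
rewrite (sum_nth (F := fun p => j < p) _ (leM b)) //.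
by apply: eq_bigr => l _; rewrite levels_part.
Qed.
End Bipartition.

(** At index k, the first inequality of bidominance is the case E = 2k + 2 and the second the case E
    = 2k + 1. *)
Lemma bidominatesP lm to :
  bidominates lm to <-> forall E, psum (levels to) E <= psum (levels lm) E.
Proof.
have even bp k : psum (levels bp) k.*2 = \sum_(j < k) (nth 0 bp.1 j + nth 0 bp.2 j).
  rewrite psum_parity uphalf_double doubleK big_split.
  by congr (_ + _); apply: eq_bigr => j _; rewrite levels_part.
have odd bp k : psum (levels bp) k.*2.+1 =
    \sum_(j < k) (nth 0 bp.1 j + nth 0 bp.2 j) + nth 0 bp.1 k.
  by rewrite psumS even -[k.*2]/(false + k.*2) levels_part.
split=> [dom E | dom k].
  have := dom (uphalf E).-1; have := dom E./2; rewrite -!odd -!even.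
  case: (boolP (ssrnat.odd E)) => oddE [_ H1] [H2 _].
    by rewrite (_ : E = E./2.*2.+1); last lia.
  case: E oddE {H1} H2 => [|E] oddE; first by rewrite !psum0.
  by rewrite (_ : (uphalf E.+1).-1.+1.*2 = E.+1) //; lia.
by rewrite -!odd -!even.
Qed.

Section Tableaux.
Variables (K : fieldType) (n M : nat) (bp : seq nat * seq nat).
Hypotheses (bp_n : bipartition n bp) (leM : forall b, size (part bp b) <= M).
Implicit Types (T S : seq (seq 'I_n)) (C : bool * 'I_n -> seq 'I_n).

Lemma part_le (b : bool) p : p \in part bp b -> p <= n.
Proof.
have [_ _ <-] := bp_n => pb; apply: (@leq_trans (sumn (part bp b))).
  by rewrite sumnE (big_rem p pb) leq_addr.
by case: b {pb}; rewrite ?leq_addl ?leq_addr.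
Qed.

Lemma perm_flatten_column T : all (fun r => size r <= n) T ->
  perm_eq (flatten T) (flatten [seq column T j | j : 'I_n]).
Proof.
move=> leT; apply/seq.permP => a; rewrite (count_flatten_column a leT).
by rewrite count_flatten sumnE !big_map -enumT big_enum.
Qed.

Lemma big_ncolumns (R : comNzRingType) (F : seq 'I_n -> R) T :
  F [::] = 1%R -> sorted geq (shape T) -> all (fun r => size r <= n) T ->
  (\prod_(j < ncolumns T) F (column T j) = \prod_(j < n) F (column T j))%R.
Proof.
move=> F0 sortT leT; have le_n : ncolumns T <= n by case: T leT {sortT} => //= r T /andP[].
rewrite (big_ord_widen n (fun j => F (column T j)) le_n) big_mkcond /=.
apply: eq_bigr => j _; case: ltnP => // le; rewrite -F0; congr F.
apply/esym/size0nil; rewrite size_column big1_seq // => p /andP[_ pT].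
apply/eqP; rewrite eqb0 -leqNgt; apply: leq_trans le.
rewrite /ncolumns; case: (shape T) sortT pT => //= q s sort_s; rewrite inE.
case/orP => [/eqP->|] //.
exact: (allP (order_path_min (rev_trans leq_trans) sort_s)).
Qed.

Definition tableau_columns T S (x : bool * 'I_n) := column (if x.1 then S else T) x.2.

Lemma specht_columns T S : bitableau bp T S ->
  specht K T S = colsys_poly K (tableau_columns T S).
Proof.
move=> [shT shS _]; have [sort1 sort2 _] := bp_n.
have leT : all (fun r => size r <= n) T.
  by rewrite -(all_map size (fun p => p <= n)) -/(shape T) shT;
     apply/allP => p; apply: (@part_le false).
have leS : all (fun r => size r <= n) S.
  by rewrite -(all_map size (fun p => p <= n)) -/(shape S) shS;
     apply/allP => p; apply: (@part_le true).
rewrite /specht (big_ncolumns (F := fun s => Delta s _)) ?Delta_nil ?shT //.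
rewrite (big_ncolumns (F := fun s => Delta s _)) ?Delta_nil ?shS //.
rewrite (perm_big _ (perm_flatten_column leS)) big_flatten big_map big_enum /=.
rewrite /colsys_poly -(pair_bigA _ (fun b j => cpoly K b (tableau_columns T S (b, j)))) /=.
rewrite big_bool /= -mulrA [RHS]mulrC; congr (_ * _)%R.
  by apply: eq_bigr => j _; rewrite /cpoly big1 ?mulr1.
by rewrite -big_split.
Qed.

Lemma colsys_columns T S : bitableau bp T S ->
  colsys M (levels bp) (tableau_columns T S).
Proof.
move=> [shT shS permTS]; split=> [[b j]|i].
  by rewrite (height_levels leM) size_column /=; case: b; rewrite ?shT ?shS.
rewrite -(pair_bigA _ (fun b j => count_mem i (tableau_columns T S (b, j)))) /=.
rewrite big_bool /= addnC -!count_flatten_column.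
- by rewrite -count_cat (seq.permP permTS) count_uniq_mem ?enum_uniq // mem_enum.
- by rewrite -(all_map size (fun p => p <= n)) -/(shape S) shS;
     apply/allP => p; apply: (@part_le true).
by rewrite -(all_map size (fun p => p <= n)) -/(shape T) shT;
     apply/allP => p; apply: (@part_le false).
Qed.

(** The columns, listed as rows, form a tableau of the conjugate shape, which is then transposed. *)
Lemma colsys_tableau C : colsys M (levels bp) C ->
  exists T S, bitableau bp T S /\ specht K T S = colsys_poly K C.
Proof.
move=> [szC cntC]; have lvl := level_seq_levels bp_n leM.
pose U b := [seq C (b, j) | j <- enum 'I_n].
have shU b : shape (U b) = [seq height M (levels bp) b j | j <- iota 0 n].
  rewrite -val_enum_ord /shape -[LHS]map_comp -[RHS]map_comp; apply: eq_map => j /=.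
  by rewrite szC.
have sortU b : sorted geq (shape (U b)).
  rewrite shU sorted_map; apply: sub_sorted (iota_ltn_sorted 0 n) => i j /= /ltnW.
  exact: height_le.
have nthU b (j : 'I_n) : nth [::] (U b) j = C (b, j).
  by rewrite (nth_map j) ?size_enum_ord // nth_ord_enum.
(* The number of rows includes the trailing zeros of the partition, since the shape must be
   literally that sequence. *)
pose tab b := mkseq (column (U b)) (size (part bp b)).
have colE b (j : 'I_n) : column (tab b) j = C (b, j).
  rewrite columnK // -(all_map size (fun p => p <= _)) -/(shape _) shU.
  apply/allP => p /mapP[i _ ->]; rewrite (height_levels leM) -sum1_size.
  by apply: leq_sum => q _; apply: leq_b1.
have shE b : shape (tab b) = part bp b.
  apply: (@eq_from_nth _ 0) => [|l]; rewrite size_map size_mkseq // => ltl.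
  rewrite (nth_map [::]) ?size_mkseq // nth_mkseq // size_column shU big_map.
  rewrite -[RHS]/(nth 0 (part bp b) l) -[n]subn0 -/(index_iota 0 n) big_mkord.
  under eq_bigr => j _ do rewrite ltn_height //.
  by rewrite sum_ltn levels_part; apply/minn_idPr/(@part_le b)/mem_nth.
have le_tab b : all (fun r => size r <= n) (tab b).
  by rewrite -(all_map size (fun p => p <= n)) -/(shape _) shE; apply/allP => p; apply: part_le.
have bitab : bitableau bp (tab false) (tab true).
  split; rewrite ?shE //; apply/allP => i _ /=.
  rewrite count_cat (count_uniq_mem _ (enum_uniq _)) mem_enum /= -(cntC i).
  rewrite !(@count_flatten_column _ _ _ n) //.
  have -> : \sum_x count_mem i (C x) = \sum_x count_mem i (C (x.1, x.2)).
    by apply: eq_bigr => -[].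
  rewrite -(pair_bigA _ (fun b j => count_mem i (C (b, j)))) /= big_bool /= addnC.
  by apply/eqP; congr (_ + _); apply: eq_bigr => j _; rewrite colE.
exists (tab false), (tab true); split=> //; rewrite specht_columns //.
by apply: eq_bigr => -[b j] _; rewrite /tableau_columns -colE; case: b.
Qed.

Lemma specht_idealP (f : {mpoly K[n]}) :
  specht_ideal bp f <-> generated_ideal (colsys_gen M (levels bp)) f.
Proof.
split; apply: generated_ideal_sub => h.
  case=> T [S [tabTS ->]]; apply: generated_ideal_gen.
  by exists (tableau_columns T S); rewrite -specht_columns //; split=> //; apply: colsys_columns.
case=> C [/colsys_tableau[T [S [tabTS eqC]]] ->]; rewrite -eqC.
by apply: generated_ideal_gen; exists T, S.
Qed.

Lemma exists_colsys : exists C, colsys M (levels bp) C.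
Proof.
have [_ _ sum_n] := bp_n; pose e := enum 'I_n.
pose T := reshape bp.1 (take (sumn bp.1) e); pose S := reshape bp.2 (drop (sumn bp.1) e).
have size_e : size e = sumn bp.1 + sumn bp.2 by rewrite size_enum_ord.
have size1 : size (take (sumn bp.1) e) = sumn bp.1 by rewrite size_takel // size_e leq_addr.
have size2 : size (drop (sumn bp.1) e) = sumn bp.2 by rewrite size_drop size_e addKn.
exists (tableau_columns T S); apply: colsys_columns; split.
- by rewrite reshapeKl // size1.
- by rewrite reshapeKl // size2.
by rewrite !reshapeKr ?size1 ?size2 // cat_take_drop.
Qed.
End Tableaux.

(** * Points of the varieties *)

Lemma pchar0_eqr_nat (K : fieldType) (charK0 : [pchar K]%R =i pred0) m k :
  ((m%:R == k%:R :> K) = (m == k))%R.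
Proof.
wlog le_mk : m k / m <= k.
  by move=> IH; case/orP: (leq_total m k) => /IH // E; rewrite eq_sym E eq_sym.
by rewrite eq_sym -subr_eq0 -natrB // (pcharf0P K).1 // subn_eq0 eqn_leq le_mk.
Qed.

Lemma Delta_neq0 (K : fieldType) n (s : seq 'I_n) (y : 'I_n -> K) :
  (Delta s y != 0)%R = uniq (map y s).
Proof.
elim: s => [|i s IH]; first by rewrite Delta_nil oner_eq0.
rewrite Delta_cons mulf_eq0 negb_or IH /= prodf_seq_neq0; congr (_ && _).
apply/allP/idP => [neq | notin j sj] /=.
  by apply/mapP => -[j sj eq_ij]; have := neq j sj; rewrite /= eq_ij subrr eqxx.
by rewrite subr_eq0; apply: contraNneq notin => ->; apply: map_f.
Qed.

Section Evaluation.
Variables (K : fieldType) (charK0 : [pchar K]%R =i pred0) (n : nat).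
Variable zeta : 'I_n -> nat.
Local Notation z := (fun i => (zeta i)%:R%R : K).

(** Coordinates are natural numbers, on which squaring is injective, and in characteristic 0 they
    stay distinct in [K]. *)
Lemma cpoly_eval_neq0 b (s : seq 'I_n) :
  ((cpoly K b s).@[z] != 0)%R = uniq (map zeta s) && (b ==> (0 \notin map zeta s)).
Proof.
have -> : ((cpoly K b s).@[z] =
    Delta s (fun i => (zeta i ^ 2)%:R) * \prod_(i <- s) (zeta i)%:R ^+ b)%R.
  rewrite /cpoly rmorphM rmorph_prod /Delta rmorph_prod; congr (_ * _)%R.
    apply: eq_bigr => i _; rewrite rmorph_prod; apply: eq_bigr => j _.
    by rewrite rmorphB /Xsq !rmorphXn /= !mevalXU -!natrX.
  by apply: eq_bigr => i _; rewrite rmorphXn /= mevalXU.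
rewrite mulf_eq0 negb_or Delta_neq0 prodf_seq_neq0; congr (_ && _).
  rewrite -(map_inj_uniq (f := fun m => (m ^ 2)%:R%R : K)) -?map_comp // => m k.
  by move/eqP; rewrite pchar0_eqr_nat // eqn_exp2r // => /eqP.
case: b => /=; last by apply/allP => i _; rewrite expr0 oner_eq0.
apply/allP/idP => [neq | notin i si] /=.
  by apply/mapP => -[i si zi]; have := neq i si; rewrite -zi expr1 eqxx.
by rewrite expr1 (pcharf0P K).1 //; apply: contraNneq notin => <-; apply: map_f.
Qed.

Lemma colsys_poly_eval_neq0 (C : bool * 'I_n -> seq 'I_n) :
  ((colsys_poly K C).@[z] != 0)%R ->
  forall x, uniq (map zeta (C x)) && (x.1 ==> (0 \notin map zeta (C x))).
Proof.
rewrite /colsys_poly rmorph_prod => /prodf_neq0 nz x.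
by rewrite -cpoly_eval_neq0 nz.
Qed.
End Evaluation.

Section RowValues.
Variables (n M : nat) (d : nat -> nat) (C : bool * 'I_n -> seq 'I_n).
Hypothesis colC : colsys M d C.

Lemma colsys_mem i : exists2 x, i \in C x & forall y, y != x -> i \notin C y.
Proof.
have [_ /(_ i) cnt1] := colC.
case: (pickP (fun x => i \in C x)) => [x Cx | none]; last first.
  by move: cnt1; rewrite big1 // => x _; apply/count_memPn; rewrite none.
exists x => // y neq; move: cnt1; rewrite (bigD1 x) //= (bigD1 y) //=.
rewrite -!has_pred1 !has_count in Cx *; move: Cx.
set p := count_mem i (C x); set q := count_mem i (C y); set r := \sum_(_ | _) _.
lia.
Qed.

Lemma colsys_uniq x : uniq (C x).
Proof.
apply/count_mem_uniq => i; have [_ /(_ i)] := colC; rewrite (bigD1 x) //=.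
case: (boolP (i \in C x)) => [|/count_memPn -> //].
by rewrite -has_pred1 has_count; set p := count_mem i (C x); set r := \sum_(_ | _) _; lia.
Qed.

Variable E : nat.

(* This value increases by 1 down each column. For odd E both first rows get 1;
   for even E they get 0 and 1, and 0 is forbidden in the second tableau. In
   both cases the levels <= E are those with value at most (E + odd E)./2. *)
Definition row_value i := \sum_(x | i \in C x) (x.1 + (index i (C x)).*2 + 1 + odd E)./2.

Lemma map_row_value x :
  map row_value (C x) = iota ((x.1 + 1 + odd E)./2) (size (C x)).
Proof.
apply: (@eq_from_nth _ 0); rewrite size_map ?size_iota // => l ltl.
have [i0 _] : exists i, i \in C x by case: (C x) ltl => // i s; exists i; rewrite mem_head.
rewrite (nth_map i0) // nth_iota // /row_value.
have [y Cy uniqy] := colsys_mem (nth i0 (C x) l).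
have eq_xy : y = x.
  by apply/eqP/contraT; rewrite eq_sym => /uniqy; rewrite mem_nth.
subst y; rewrite (bigD1 x) ?mem_nth //= big1 => [|y /andP[Cy' /uniqy]]; last by rewrite Cy'.
rewrite index_uniq ?colsys_uniq //; lia.
Qed.

Lemma row_value_ge i : odd E <= row_value i.
Proof.
have [x Cx _] := colsys_mem i; have : row_value i \in map row_value (C x) by apply: map_f.
rewrite map_row_value mem_iota => /andP[le _]; apply: leq_trans le; lia.
Qed.

(** In a column of tableau [b] the small values are those of the first (E + 2 - b)./2 rows, the rows
    at levels at most [E]. *)
Lemma sum_row_value_le : level_seq M.*2 d -> psum d M.*2 <= n ->
  \sum_i (row_value i <= (E + odd E)./2) = psum d E.+1.
Proof.
move=> lvd le_n; rewrite (sum_colsys _ colC).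
rewrite -(sum_minn_height (k := fun b => (E.+2 - b)./2) lvd le_n) //.
apply: eq_bigr => x _; have [szC _] := colC; rewrite -szC.
rewrite -(big_map row_value predT (fun v => (v <= (E + odd E)./2) : nat)) map_row_value.
elim: (size (C x)) => [|m IH]; first by rewrite big_nil min0n.
rewrite -[m.+1]addn1 iotaD big_cat IH big_seq1 /=; case: (x.1); lia.
Qed.
End RowValues.

(* A nonvanishing column carries distinct values, nonzero ones if it belongs to
   the second tableau; so at most (E.+2 - b)./2 of them are small, which is the
   number of levels <= E of parity b. *)
Lemma colsys_poly_eval_count (K : fieldType) (charK0 : [pchar K]%R =i pred0) n M c
    (C : bool * 'I_n -> seq 'I_n) (E : nat) (zeta : 'I_n -> nat) :
  level_seq M.*2 c -> psum c M.*2 <= n -> colsys M c C ->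
  (forall i, odd E <= zeta i) ->
  ((colsys_poly K C).@[fun i => (zeta i)%:R] != 0)%R ->
  \sum_i (zeta i <= (E + odd E)./2) <= psum c E.+1.
Proof.
move=> lvc le_n colC zeta_ge nz; rewrite (sum_colsys _ colC).
rewrite -(sum_minn_height (k := fun b => (E.+2 - b)./2) lvc le_n) //.
apply: leq_sum => x _; have [szC _] := colC; rewrite -szC.
have /andP[uniqx nz0] := colsys_poly_eval_neq0 charK0 nz x.
rewrite -(big_map zeta predT (fun v => (v <= (E + odd E)./2) : nat)).
rewrite leq_min; apply/andP; split.
  by rewrite -(size_map zeta) -sum1_size leq_sum // => v _; apply: leq_b1.
rewrite -big_mkcond sum1_count -size_filter.
(* Pigeonhole: the small values are distinct and lie in this interval. In the second tableau its
   lower end 1 comes from v <> 0 when [E] is even, and from v >= [odd E] when it is odd. *)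
rewrite -[X in _ <= X](size_iota ((x.1 + 1 + odd E)./2)).
apply: uniq_leq_size; first exact: filter_uniq.
move=> v; rewrite mem_filter mem_iota => /andP[le_v v_in].
have v_ge : odd E <= v by have /mapP[i _ ->] := v_in.
move: nz0; case: (x.1) => /= [/memPn/(_ _ v_in) v_neq0|_]; lia.
Qed.

(** * The cycle of implications *)

Local Open Scope ring_scope.

Theorem theorem5 (K : fieldType) (charK0 : [pchar K] =i pred0) (n : nat)
    (la mu th om : seq nat)
    (lamu_n : bipartition n (la, mu)) (thom_n : bipartition n (th, om)) :
  (bidominates (la, mu) (th, om) <->
   (forall f : {mpoly K[n]},
      specht_ideal (th, om) f -> specht_ideal (la, mu) f)) /\
  ((forall f : {mpoly K[n]},
      specht_ideal (th, om) f -> specht_ideal (la, mu) f) <->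
   (forall z : 'I_n -> K,
      specht_variety (la, mu) z -> specht_variety (th, om) z)).
Proof.
pose M := maxn (maxn (size la) (size mu)) (maxn (size th) (size om)).
have leM1 b : (size (part (la, mu) b) <= M)%N by case: b; rewrite /= /M; lia.
have leM2 b : (size (part (th, om) b) <= M)%N by case: b; rewrite /= /M; lia.
pose c := levels (la, mu); pose d := levels (th, om).
have lvc : level_seq M.*2 c := level_seq_levels lamu_n leM1.
have lvd : level_seq M.*2 d := level_seq_levels thom_n leM2.
have sum_c : psum c M.*2 = n := psum_levels lamu_n leM1.
have sum_d : psum d M.*2 = n := psum_levels thom_n leM2.
have imp12 : bidominates (la, mu) (th, om) ->
    forall f : {mpoly K[n]}, specht_ideal (th, om) f -> specht_ideal (la, mu) f.
  move=> /bidominatesP dom f /(specht_idealP thom_n leM2) If.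
  apply/(specht_idealP lamu_n leM1); apply: generated_ideal_sub If => h [C [colC ->]].
  exact: (colsys_dominated charK0 lvc lvd).
have imp23 : (forall f : {mpoly K[n]}, specht_ideal (th, om) f -> specht_ideal (la, mu) f) ->
    forall z : 'I_n -> K, specht_variety (la, mu) z -> specht_variety (th, om) z.
  by move=> sub z Vz f If; apply: Vz; apply: sub.
have imp31 : (forall z : 'I_n -> K, specht_variety (la, mu) z -> specht_variety (th, om) z) ->
    bidominates (la, mu) (th, om).
  move=> subV; apply/bidominatesP => -[|E]; first by rewrite !psum0.
  rewrite leqNgt; apply/negP => ltE.
  have [C colC] := exists_colsys thom_n leM2.
  pose zeta := row_value C E; pose z i : K := (zeta i)%:R.
  have Vz : specht_variety (la, mu) z.
    move=> f /(specht_idealP lamu_n leM1)[s [Gs ->]].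
    rewrite rmorph_sum big_seq big1 // => p /Gs[C' [colC' ->]].
    rewrite rmorphM /=; suff /eqP-> : (colsys_poly K C').@[z] == 0 by rewrite mulr0.
    (* The number of small coordinates of [z] is the partial sum of d at E + 1; a nonvanishing
       generator of shape (la, mu) would bound it by that of c. *)
    apply: contraLR ltE => nz; rewrite -leqNgt -(sum_row_value_le colC E lvd) ?sum_d //.
    apply: (colsys_poly_eval_count charK0 lvc _ colC' _ nz); first by rewrite sum_c.
    exact: (row_value_ge colC).
  have /eqP : (colsys_poly K C).@[z] = 0.
    apply: (subV z Vz); apply/(specht_idealP thom_n leM2).
    by apply: generated_ideal_gen; exists C.
  (* On its own columns [zeta] takes consecutive values, starting at 1 in the second tableau, so no
     factor vanishes. *)
  apply/negP; rewrite /colsys_poly rmorph_prod; apply/prodf_neq0 => x _.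
  rewrite cpoly_eval_neq0 // (map_row_value colC) iota_uniq mem_iota.
  by case: (x.1) => //=; lia.
by split; split=> // H; [apply/imp31/imp23 | apply/imp12/imp31].
Qed.
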